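(* Let $\mathbb{F}$ be a finite field, $q=|\mathbb{F}|$, let $\mathbb{E}/\mathbb{F}$ be a quadratic extension, let $\alpha\in\mathbb{E}$, and consider the $\mathbb{F}$-algebra $\mathbb{E}$ with the trace $t_\alpha(x)=\alpha x$. Then $\mathrm{Id}(\mathbb{E},t_\alpha)$ follows from (that is, is equal to the T-ideal generated by) the following polynomials: (i) $m_\alpha(t(1))$, where $m_\alpha(x)\in\mathbb{F}[x]$ is the minimal polynomial of $\alpha$ over $\mathbb{F}$; (ii) $t(x)-t(1)x$; (iii) $x^{q^2}-x$; (iv) all Capelli polynomials of order $2$.
   Context: Algebras are associative over $\mathbb{F}$. A trace on an algebra $\mathcal{A}$ is an $\mathbb{F}$-linear map $t:\mathcal{A}\to\mathcal{A}$ such that for all $a,b$: $t(a)\in Z(\mathcal{A})$, $t(ab)=t(ba)$, $t(t(a)b)=t(a)t(b)$. A trace algebra is an algebra with a trace. $\mathbb{F}\langle X,t\rangle$ denotes the free unital associative trace algebra freely generated by an infinite set $X$ of variables, i.e. the free algebra of the variety of unital associative algebras with a linear unary operation $t$ satisfying $t(x)y=yt(x)$, $t(xy)=t(yx)$, $t(t(x)y)=t(x)t(y)$ (here $t(1)$ is not assumed to be a scalar). For a unital trace algebra $(\mathcal{A},t)$, $\mathrm{Id}(\mathcal{A},t)\subseteq\mathbb{F}\langle X,t\rangle$ is the set of all trace polynomials vanishing under every substitution of the variables by elements of $\mathcal{A}$. A T-ideal is a two-sided ideal of $\mathbb{F}\langle X,t\rangle$ closed under $t$ and under all (trace-algebra)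 endomorphisms of $\mathbb{F}\langle X,t\rangle$; $\langle S\rangle$ is the smallest T-ideal containing $S$. ''$\mathrm{Id}(\mathcal{A},t)$ follows from $S$'' means $\mathrm{Id}(\mathcal{A},t)=\langle S\rangle$. A Capelli polynomial of order $m$ is a multilinear polynomial $f(x_1,\ldots,x_m,y_1,\ldots,y_r)\in\mathbb{F}\langle X,t\rangle$ that is alternating in $\{x_1,\ldots,x_m\}$. In the paper, each Capelli polynomial of order $m$ is a consequence of $[x,y]=xy-yx$ and the single polynomial $\sum_{\sigma\in\mathcal{S}_m}(-1)^\sigma t(y_1x_{\sigma(1)})\cdots t(y_{m-1}x_{\sigma(m-1)})y_mx_{\sigma(m)}$, where $(-1)^\sigma$ is the sign of $\sigma$. *)

(* Defs.v *)
From HB Require Import structures.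
From mathcomp Require Import all_boot all_order all_algebra all_field.
From mathcomp Require Import boolp classical_sets cardinality.

Set Implicit Arguments.
Unset Strict Implicit.
Unset Printing Implicit Defensive.

Import GRing.Theory.
Local Open Scope quotient_scope.
Local Open Scope ring_scope.

Record trace (F : fieldType) (A : algType F) := Trace {
  trace_fun :> A -> A;
  trace_linear : linear trace_fun;
  trace_central : forall a b, trace_fun a * b = b * trace_fun a;
  traceC : forall a b, trace_fun (a * b) = trace_fun (b * a);
  trace_trace : forall a b,
    trace_fun (trace_fun a * b) = trace_fun a * trace_fun b }.

HB.instance Definition _ (F : fieldType) (A : algType F) (t : trace A) :=
  GRing.isLinear.Build F A A *:%R (t : A -> A) (trace_linear t).

Section ScaleTrace.
Variables (F : fieldType) (A : comAlgType F) (alpha : A).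
Let t (x : A) := alpha * x.
Fact scale_trace_linear : linear t.
Proof. by move=> k x y; rewrite /t mulrDr scalerAr. Qed.
Fact scale_trace_central a b : t a * b = b * t a.
Proof. exact: mulrC. Qed.
Fact scale_traceC a b : t (a * b) = t (b * a).
Proof. by rewrite /t [a * b]mulrC. Qed.
Fact scale_trace_trace a b : t (t a * b) = t a * t b.
Proof. by rewrite /t mulrCA. Qed.
Definition scale_trace : trace A :=
  Trace scale_trace_linear scale_trace_central scale_traceC scale_trace_trace.
End ScaleTrace.

(* The free unital trace algebra is the algebra of terms modulo the least     *)
(* congruence containing the identities of unital trace algebras.             *)
Inductive term (F X : Type) : Type :=
| Tvar of X
| Tzero
| Tone
| Tadd of term F X & term F X
| Tscale of F & term F X
| Tmul of term F X & term F X
| Ttr of term F X.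

Arguments Tvar {F X} x.
Arguments Tzero {F X}.
Arguments Tone {F X}.

Inductive teq (F : fieldType) (X : Type) : term F X -> term F X -> Prop :=
| teq_refl u : teq u u
| teq_sym u v : teq u v -> teq v u
| teq_trans u v w : teq u v -> teq v w -> teq u w
| teq_add u u' v v' : teq u u' -> teq v v' -> teq (Tadd u v) (Tadd u' v')
| teq_scale k u u' : teq u u' -> teq (Tscale k u) (Tscale k u')
| teq_mul u u' v v' : teq u u' -> teq v v' -> teq (Tmul u v) (Tmul u' v')
| teq_tr u u' : teq u u' -> teq (Ttr u) (Ttr u')
| teq_addA u v w : teq (Tadd u (Tadd v w)) (Tadd (Tadd u v) w)
| teq_addC u v : teq (Tadd u v) (Tadd v u)
| teq_add0 u : teq (Tadd Tzero u) u
| teq_scaleA j k u : teq (Tscale j (Tscale k u)) (Tscale (j * k) u)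
| teq_scale0 u : teq (Tscale 0 u) Tzero
| teq_scale1 u : teq (Tscale 1 u) u
| teq_scaleDr k u v :
    teq (Tscale k (Tadd u v)) (Tadd (Tscale k u) (Tscale k v))
| teq_scaleDl j k u : teq (Tscale (j + k) u) (Tadd (Tscale j u) (Tscale k u))
| teq_mulA u v w : teq (Tmul u (Tmul v w)) (Tmul (Tmul u v) w)
| teq_mul1l u : teq (Tmul Tone u) u
| teq_mul1r u : teq (Tmul u Tone) u
| teq_mulDl u v w : teq (Tmul (Tadd u v) w) (Tadd (Tmul u w) (Tmul v w))
| teq_mulDr u v w : teq (Tmul u (Tadd v w)) (Tadd (Tmul u v) (Tmul u w))
| teq_scaleAl k u v : teq (Tscale k (Tmul u v)) (Tmul (Tscale k u) v)
| teq_scaleAr k u v : teq (Tscale k (Tmul u v)) (Tmul u (Tscale k v))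
| teq_trD u v : teq (Ttr (Tadd u v)) (Tadd (Ttr u) (Ttr v))
| teq_trZ k u : teq (Ttr (Tscale k u)) (Tscale k (Ttr u))
| teq_tr_central u v : teq (Tmul (Ttr u) v) (Tmul v (Ttr u))
| teq_trC u v : teq (Ttr (Tmul u v)) (Ttr (Tmul v u))
| teq_tr_tr u v : teq (Ttr (Tmul (Ttr u) v)) (Tmul (Ttr u) (Ttr v)).

Section TermEval.
Variables (F : fieldType) (A : algType F) (X : Type).
Variables (t : trace A) (v : X -> A).

Fixpoint term_eval (u : term F X) : A :=
  match u with
  | Tvar x => v x
  | Tzero => 0
  | Tone => 1
  | Tadd u1 u2 => term_eval u1 + term_eval u2
  | Tscale k u1 => k *: term_eval u1
  | Tmul u1 u2 => term_eval u1 * term_eval u2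
  | Ttr u1 => t (term_eval u1)
  end.

Lemma teq_eval u u' : teq u u' -> term_eval u = term_eval u'.
Proof.
elim=> //=.
- by move=> ? ? ? _ -> _ ->.
- by move=> ? ? ? ? _ -> _ ->.
- by move=> ? ? ? _ ->.
- by move=> ? ? ? ? _ -> _ ->.
- by move=> ? ? _ ->.
- by move=> *; rewrite addrA.
- by move=> *; rewrite addrC.
- by move=> *; rewrite add0r.
- by move=> *; rewrite scalerA.
- by move=> *; rewrite scale0r.
- by move=> *; rewrite scale1r.
- by move=> *; rewrite scalerDr.
- by move=> *; rewrite scalerDl.
- by move=> *; rewrite mulrA.
- by move=> *; rewrite mul1r.
- by move=> *; rewrite mulr1.
- by move=> *; rewrite mulrDl.
- by move=> *; rewrite mulrDr.
- by move=> *; rewrite scalerAl.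
- by move=> *; rewrite scalerAr.
- by move=> *; rewrite linearD.
- by move=> *; rewrite linearZ.
- by move=> *; rewrite trace_central.
- by move=> *; rewrite traceC.
- by move=> *; rewrite trace_trace.
Qed.
End TermEval.

HB.instance Definition _ (F X : Type) := gen_eqMixin (term F X).
HB.instance Definition _ (F X : Type) := gen_choiceMixin (term F X).

Section FreeTraceAlgebra.
Variables (F : fieldType) (X : Type).
Local Notation T := (term F X).

Definition teqb : rel T := fun u v => `[< teq u v >].

Fact teqb_refl : reflexive teqb.
Proof. by move=> u; apply/asboolP; exact: teq_refl. Qed.
Fact teqb_sym : symmetric teqb.
Proof. by move=> u v; apply/asboolP/asboolP; exact: teq_sym. Qed.
Fact teqb_trans : transitive teqb.
Proof.
by move=> v u w /asboolP uv /asboolP vw; apply/asboolP; exact: teq_trans vw.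
Qed.
Canonical teqb_equiv := EquivRel teqb teqb_refl teqb_sym teqb_trans.

Definition trace_poly := {eq_quot teqb}.
HB.instance Definition _ := Choice.on trace_poly.
HB.instance Definition _ := EqQuotient.on trace_poly.

Local Notation P := trace_poly.

Lemma trace_poly_eqP (u v : T) : teq u v <-> \pi_P u = \pi_P v.
Proof.
split=> [uv|/eqP]; first by apply/eqP; rewrite eqmodE; apply/asboolP.
by rewrite eqmodE => /asboolP.
Qed.

Lemma teq_repr (u : T) : teq (repr (\pi_P u)) u.
Proof. by apply/trace_poly_eqP; rewrite reprK. Qed.

Definition tp_zero : P := \pi_P Tzero.
Definition tp_one : P := \pi_P Tone.
(* Locked: otherwise \pi_P u unifies with tp_add f g by unfolding the latter. *)
Definition tp_add : P -> P -> P :=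
  locked (fun f g => \pi_P (Tadd (repr f) (repr g))).
Definition tp_scale : F -> P -> P :=
  locked (fun k f => \pi_P (Tscale k (repr f))).
Definition tp_mul : P -> P -> P :=
  locked (fun f g => \pi_P (Tmul (repr f) (repr g))).
Definition tp_tr : P -> P := locked (fun f => \pi_P (Ttr (repr f))).

Lemma tp_addE u v : tp_add (\pi_P u) (\pi_P v) = \pi_P (Tadd u v).
Proof.
rewrite /tp_add -lock; apply/trace_poly_eqP.
by apply: teq_add; exact: teq_repr.
Qed.
Lemma tp_scaleE k u : tp_scale k (\pi_P u) = \pi_P (Tscale k u).
Proof.
rewrite /tp_scale -lock; apply/trace_poly_eqP.
by apply: teq_scale; exact: teq_repr.
Qed.
Lemma tp_mulE u v : tp_mul (\pi_P u) (\pi_P v) = \pi_P (Tmul u v).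
Proof.
rewrite /tp_mul -lock; apply/trace_poly_eqP.
by apply: teq_mul; exact: teq_repr.
Qed.
Lemma tp_trE u : tp_tr (\pi_P u) = \pi_P (Ttr u).
Proof.
rewrite /tp_tr -lock; apply/trace_poly_eqP.
by apply: teq_tr; exact: teq_repr.
Qed.
Let tpE := (tp_addE, tp_scaleE, tp_mulE, tp_trE).

Fact tp_addA : associative tp_add.
Proof.
elim/quotW=> u; elim/quotW=> v; elim/quotW=> w; rewrite !tpE.
by apply/trace_poly_eqP; exact: teq_addA.
Qed.
Fact tp_addC : commutative tp_add.
Proof.
elim/quotW=> u; elim/quotW=> v; rewrite !tpE.
by apply/trace_poly_eqP; exact: teq_addC.
Qed.
Fact tp_add0 : left_id tp_zero tp_add.
Proof.
by elim/quotW=> u; rewrite tpE; apply/trace_poly_eqP; exact: teq_add0.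
Qed.
Fact tp_addN : left_inverse tp_zero (tp_scale (-1)) tp_add.
Proof.
elim/quotW=> u; rewrite !tpE; apply/trace_poly_eqP.
apply: teq_trans (teq_scale0 u); rewrite -(addNr 1).
apply: teq_sym; apply: teq_trans (teq_scaleDl _ _ _) _.
by apply: teq_add (teq_refl _) _; exact: teq_scale1.
Qed.
HB.instance Definition _ :=
  GRing.isZmodule.Build P tp_addA tp_addC tp_add0 tp_addN.

Fact tp_mulA : associative tp_mul.
Proof.
elim/quotW=> u; elim/quotW=> v; elim/quotW=> w; rewrite !tpE.
by apply/trace_poly_eqP; exact: teq_mulA.
Qed.
Fact tp_mul1l : left_id tp_one tp_mul.
Proof.
by elim/quotW=> u; rewrite tpE; apply/trace_poly_eqP; exact: teq_mul1l.
Qed.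
Fact tp_mul1r : right_id tp_one tp_mul.
Proof.
by elim/quotW=> u; rewrite tpE; apply/trace_poly_eqP; exact: teq_mul1r.
Qed.
Fact tp_mulDl : left_distributive tp_mul +%R.
Proof.
elim/quotW=> u; elim/quotW=> v; elim/quotW=> w.
rewrite /GRing.add /= !tpE.
by apply/trace_poly_eqP; exact: teq_mulDl.
Qed.
Fact tp_mulDr : right_distributive tp_mul +%R.
Proof.
elim/quotW=> u; elim/quotW=> v; elim/quotW=> w.
rewrite /GRing.add /= !tpE.
by apply/trace_poly_eqP; exact: teq_mulDr.
Qed.
Fact tp_one_neq0 : tp_one != 0.
Proof.
apply/eqP=> /trace_poly_eqP /(teq_eval (scale_trace (0 : F^o)) (fun=> 0)) /=.
by apply/eqP; exact: oner_neq0.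
Qed.
HB.instance Definition _ := GRing.Zmodule_isNzRing.Build P
  tp_mulA tp_mul1l tp_mul1r tp_mulDl tp_mulDr tp_one_neq0.

Fact tp_scaleA j k f : tp_scale j (tp_scale k f) = tp_scale (j * k) f.
Proof.
by elim/quotW: f => u; rewrite !tpE; apply/trace_poly_eqP; exact: teq_scaleA.
Qed.
Fact tp_scale1 : left_id 1 tp_scale.
Proof.
by elim/quotW=> u; rewrite tpE; apply/trace_poly_eqP; exact: teq_scale1.
Qed.
Fact tp_scaleDr : right_distributive tp_scale +%R.
Proof.
move=> k; elim/quotW=> u; elim/quotW=> v; rewrite /GRing.add /= !tpE.
by apply/trace_poly_eqP; exact: teq_scaleDr.
Qed.
Fact tp_scaleDl f : {morph tp_scale^~ f : j k / j + k}.
Proof.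
elim/quotW: f => u j k /=; rewrite [in RHS]/GRing.add /= !tpE.
by apply/trace_poly_eqP; exact: teq_scaleDl.
Qed.
HB.instance Definition _ := GRing.Zmodule_isLmodule.Build F P
  tp_scaleA tp_scale1 tp_scaleDr tp_scaleDl.

Fact tp_scaleAl k (f g : P) : k *: (f * g) = (k *: f) * g.
Proof.
elim/quotW: f => u; elim/quotW: g => v.
rewrite /GRing.mul /GRing.scale /= !tpE.
by apply/trace_poly_eqP; exact: teq_scaleAl.
Qed.
HB.instance Definition _ := GRing.Lmodule_isLalgebra.Build F P tp_scaleAl.

Fact tp_scaleAr k (f g : P) : k *: (f * g) = f * (k *: g).
Proof.
elim/quotW: f => u; elim/quotW: g => v.
rewrite /GRing.mul /GRing.scale /= !tpE.
by apply/trace_poly_eqP; exact: teq_scaleAr.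
Qed.
HB.instance Definition _ := GRing.Lalgebra_isAlgebra.Build F P tp_scaleAr.

Fact tp_tr_linear : linear tp_tr.
Proof.
move=> k; elim/quotW=> u; elim/quotW=> v.
rewrite /GRing.add /GRing.scale /= !tpE; apply/trace_poly_eqP.
by apply: teq_trans (teq_trD _ _) _; apply: teq_add (teq_trZ _ _) (teq_refl _).
Qed.
Fact tp_tr_central (f g : P) : tp_tr f * g = g * tp_tr f.
Proof.
elim/quotW: f => u; elim/quotW: g => v; rewrite /GRing.mul /= !tpE.
by apply/trace_poly_eqP; exact: teq_tr_central.
Qed.
Fact tp_trC (f g : P) : tp_tr (f * g) = tp_tr (g * f).
Proof.
elim/quotW: f => u; elim/quotW: g => v; rewrite /GRing.mul /= !tpE.
by apply/trace_poly_eqP; exact: teq_trC.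
Qed.
Fact tp_tr_tr (f g : P) : tp_tr (tp_tr f * g) = tp_tr f * tp_tr g.
Proof.
elim/quotW: f => u; elim/quotW: g => v; rewrite /GRing.mul /= !tpE.
by apply/trace_poly_eqP; exact: teq_tr_tr.
Qed.
Definition free_trace : trace P :=
  Trace tp_tr_linear tp_tr_central tp_trC tp_tr_tr.

Definition tpvar (x : X) : P := \pi_P (Tvar x).

End FreeTraceAlgebra.

Arguments tpvar F {X} x.
Arguments free_trace {F X}.

(* teval t v f is the value of f under the substitution x |-> v x; the lemmas *)
(* below say that it is the unique morphism of trace algebras with this       *)
(* effect on the variables.                                                   *)
Definition teval (F : fieldType) (A : algType F) (X : Type) (t : trace A)
  (v : X -> A) (f : trace_poly F X) : A := term_eval t v (repr f).

Section Eval.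
Variables (F : fieldType) (A : algType F) (X : Type).
Variables (t : trace A) (v : X -> A).
Local Notation P := (trace_poly F X).

Lemma teval_pi u : teval t v (\pi_P u) = term_eval t v u.
Proof. by apply: teq_eval; exact: teq_repr. Qed.

Fact teval_linear : linear (teval t v).
Proof.
move=> k; elim/quotW=> u; elim/quotW=> w.
rewrite {1}/GRing.add {1}/GRing.scale /=.
by rewrite tp_scaleE tp_addE !teval_pi.
Qed.
HB.instance Definition _ :=
  GRing.isLinear.Build F P A *:%R (teval t v) teval_linear.

Fact teval_monoid_morphism : monoid_morphism (teval t v).
Proof.
split; first exact: (teval_pi Tone).
elim/quotW=> u; elim/quotW=> w.
by rewrite {1}/GRing.mul /= tp_mulE !teval_pi.
Qed.
HB.instance Definition _ :=
  GRing.isMonoidMorphism.Build P A (teval t v) teval_monoid_morphism.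

Lemma teval_var x : teval t v (tpvar F x) = v x.
Proof. exact: teval_pi. Qed.

Lemma teval_tr f : teval t v (free_trace f) = t (teval t v f).
Proof. by elim/quotW: f => u; rewrite /= tp_trE !teval_pi. Qed.

Lemma teval_unique (phi : {lrmorphism P -> A}) :
    (forall f, phi (free_trace f) = t (phi f)) ->
    (forall x, phi (tpvar F x) = v x) ->
  phi =1 teval t v.
Proof.
move=> phi_t phi_v; elim/quotW=> u; rewrite teval_pi.
elim: u => [x|||u IHu w IHw|k u IHu|u IHu w IHw|u IHu] /=.
- exact: phi_v.
- exact: (raddf0 phi).
- exact: (rmorph1 phi).
- by rewrite -tp_addE -IHu -IHw; exact: (raddfD phi).
- by rewrite -tp_scaleE -IHu; exact: (linearZZ phi).
- by rewrite -tp_mulE -IHu -IHw; exact: (rmorphM phi).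
- by rewrite -tp_trE -IHu; exact: phi_t.
Qed.
End Eval.

Local Open Scope classical_set_scope.

Definition Id (F : fieldType) (A : algType F) (X : Type) (t : trace A) :
    set (trace_poly F X) :=
  [set f | forall v : X -> A, teval t v f = 0].

Arguments Id {F A} X t.

Section TIdeals.
Variables (F : fieldType) (X : Type).
Local Notation P := (trace_poly F X).

Record Tideal (I : set P) : Prop := {
  Tideal0 : I 0;
  TidealD : forall f g, I f -> I g -> I (f + g);
  TidealMl : forall f g, I g -> I (f * g);
  TidealMr : forall f g, I f -> I (f * g);
  Tideal_tr : forall f, I f -> I (free_trace f);
  Tideal_endo : forall phi : {lrmorphism P -> P},
    (forall f, phi (free_trace f) = free_trace (phi f)) ->
    forall f, I f -> I (phi f) }.

Definition Tgen (S : set P) : set P := smallest Tideal S.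
End TIdeals.

Section Capelli.
Variables (F : fieldType) (X : choiceType).
Local Notation P := (trace_poly F X).

(* trace_monomial s w: w is a monomial in the variables and the operation t,  *)
(* and s lists the occurrences of variables in w.                             *)
Inductive trace_monomial : seq X -> P -> Prop :=
| trace_monomial1 : trace_monomial [::] 1
| trace_monomial_var x : trace_monomial [:: x] (tpvar F x)
| trace_monomialM s1 s2 w1 w2 : trace_monomial s1 w1 ->
    trace_monomial s2 w2 -> trace_monomial (s1 ++ s2) (w1 * w2)
| trace_monomial_tr s w :
    trace_monomial s w -> trace_monomial s (free_trace w).

(* Linearity is read on monomials: over a finite field of order q, t(x)^q is  *)
(* also additive and homogeneous in x for substitutions.                      *)
Definition multilinear (vs : seq X) (f : P) : Prop :=
  exists (n : nat) (c : 'I_n -> F) (w : 'I_n -> P),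
    (forall i, exists2 s, perm_eq s vs & trace_monomial s (w i)) /\
    f = \sum_(i < n) c i *: w i.

(* Alternation is vanishing under identification of two variables. In         *)
(* characteristic 2 this is stronger than a change of sign under              *)
(* transpositions: t(x1)t(x2) is symmetric but not alternating.               *)
Definition alternating (m : nat) (x : 'I_m -> X) (f : P) : Prop :=
  forall i j : 'I_m, i != j ->
    teval free_trace (fun z => tpvar F (if z == x j then x i else z)) f = 0.

Definition capelli (m : nat) : set P :=
  [set f | exists (x : 'I_m -> X) (y : seq X),
     [/\ uniq (codom x ++ y), multilinear (codom x ++ y) f
       & alternating x f]].
End Capelli.

Arguments capelli F X m : clear implicits.

Section MinPoly.
Variables (F : fieldType) (E : fieldExtType F) (a : E).

(* minPoly 1 a has coefficients in E; min_poly a is its preimage over F. *)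
Definition min_poly : {poly F} :=
  sval (sig_eqW (polyOver1P (minPolyOver 1%AS a))).

Lemma map_min_poly : map_poly (in_alg E) min_poly = minPoly 1%AS a.
Proof. by rewrite /min_poly; case: sig_eqW. Qed.
End MinPoly.

(* Main.v *)
Require Import Defs.
From mathcomp Require Import all_boot all_order all_algebra all_field.
From mathcomp Require Import boolp classical_sets cardinality.

(** Let [J] be the T-ideal on the right-hand side of the theorem, [tau] the
    element [t(1)] and [N = q ^ 2 = #|E|].

    The inclusion of [J] in the identities is a verification on generators,
    because identities form a T-ideal ([Tideal_Id]).  The only generators that
    need an argument are the Capelli polynomials ([capelli_Id]): all monomials
    of a multilinear polynomial [f] contain the same variables, so that in [E]
    they differ only by powers of [alpha], and [f] takes the value
    [C * \prod_x v x] with a constant [C].  Alternation makes [f] vanish when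
    two variables are identified and all are sent to 1, which says [C = 0].

    For the converse, the commutator is a Capelli polynomial of order 2, so
    modulo [J] products commute, [t] is multiplication by [tau] and every
    element is equal to its [N]-th power.  Hence each trace polynomial is
    congruent to a polynomial in [tau] and finitely many variables, of degree
    less than [N] in each variable ([reducible_uniq]).  Suppose such a
    polynomial vanishes on [E].  As a polynomial in one of its variables it has
    degree less than [N] and vanishes at the [N] points of [E], so that its
    coefficients, which involve fewer variables, vanish on [E] as well
    ([small_poly_eq0]); by induction they belong to [J].  When no variable is
    left, the identity is [p(tau)] with [p(alpha) = 0], and then the minimal
    polynomial of [alpha] divides [p], which puts [p(tau)] in [J]
    ([reducible_Id]). *)

Import GRing.Theory.
Local Open Scope classical_set_scope.
Local Open Scope ring_scope.

Set Implicit Arguments.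
Unset Strict Implicit.
Unset Printing Implicit Defensive.

(** * Evaluations and identities *)

Section Evaluation.
Variables (F : fieldType) (A : algType F) (X : Type) (t : trace A).
Local Notation P := (trace_poly F X).

Lemma teval_horner_tr1 (v : X -> A) (p : {poly F}) :
  teval t v (horner_alg (free_trace 1) p) = horner_alg (t 1) p.
Proof.
elim/poly_ind: p => [|p c IHp]; first by rewrite !rmorph0.
rewrite !rmorphD !rmorphM /= !horner_algX !horner_algC IHp.
by rewrite teval_tr linearZ /= !rmorph1.
Qed.

(** Both sides are morphisms of trace algebras with the same effect on the
    variables.  This is what makes identities stable under endomorphisms, and
    it also computes an evaluation after a substitution. *)
Lemma teval_endo (phi : {lrmorphism P -> P}) (v : X -> A) (f : P) :
    (forall g, phi (free_trace g) = free_trace (phi g)) ->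
  teval t v (phi f) = teval t (fun x => teval t v (phi (tpvar F x))) f.
Proof.
move=> phi_tr.
apply: (@teval_unique F A X t _ (teval t v \o phi)) => // g /=.
by rewrite phi_tr teval_tr.
Qed.

Lemma Tideal_Id : Tideal (Id X t).
Proof.
split=> [v|f g If Ig v|f g Ig v|f g If v|f If v|phi phi_tr f If v].
- exact: raddf0.
- by rewrite raddfD /= If Ig addr0.
- by rewrite rmorphM /= Ig mulr0.
- by rewrite rmorphM /= If mul0r.
- by rewrite teval_tr If raddf0.
- by rewrite teval_endo.
Qed.

End Evaluation.

(** * Congruence modulo a T-ideal *)

Section CongruenceModuloTideal.
Variables (F : fieldType) (X : Type) (I : set (trace_poly F X)).
Variables (idealI : Tideal I).
Local Notation P := (trace_poly F X).

Definition cong (f g : P) : Prop := I (f - g).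

Lemma cong_refl f : cong f f.
Proof. by rewrite /cong subrr; exact: Tideal0. Qed.

Lemma cong_trans g f h : cong f g -> cong g h -> cong f h.
Proof.
move=> fg gh; rewrite /cong -(subrK g f) -addrA; exact: TidealD.
Qed.

Lemma congD f f' g g' : cong f f' -> cong g g' -> cong (f + g) (f' + g').
Proof.
by move=> ff' gg'; rewrite /cong opprD addrACA; exact: TidealD.
Qed.

(** [f g - f' g'] is [(f - f') g + f' (g - g')]: each summand uses one side of
    the two-sided ideal. *)
Lemma congM f f' g g' : cong f f' -> cong g g' -> cong (f * g) (f' * g').
Proof.
move=> ff' gg'; rewrite /cong -(subrK (f' * g) (f * g)) -addrA -mulrBl -mulrBr.
by apply: (TidealD idealI); [exact: TidealMr | exact: TidealMl].
Qed.

Lemma Tideal_cong f g : cong f g -> I g -> I f.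
Proof. by move=> fg Ig; rewrite -(subrK g f); exact: TidealD. Qed.

(** Substituting arbitrary trace polynomials for the variables is an
    endomorphism; a membership in [I] that holds for variables therefore holds
    for all elements. *)
Lemma Tideal_subst (v : X -> P) f : I f -> I (teval free_trace v f).
Proof.
exact: (Tideal_endo idealI (phi := teval free_trace v) (teval_tr free_trace v)).
Qed.

Lemma Tideal_Tgen (S : set P) : Tideal (Tgen S).
Proof.
split=> [K SK|f g Sf Sg K SK|f g Sg K SK|f g Sf K SK|f Sf K SK
        |phi phi_tr f Sf K SK]; have iK := SK.1.
- exact: Tideal0.
- by apply: TidealD; [exact: iK | exact: Sf | exact: Sg].
- by apply: TidealMl; [exact: iK | exact: Sg].
- by apply: TidealMr; [exact: iK | exact: Sf].
- by apply: Tideal_tr; [exact: iK | exact: Sf].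
- by apply: Tideal_endo; [exact: iK | exact: phi_tr | exact: Sf].
Qed.

End CongruenceModuloTideal.

(** * Reduction to bounded degree in each variable *)

Section Reduction.
Variables (F : fieldType) (X : choiceType) (I : set (trace_poly F X)).
Variables (idealI : Tideal I) (N : nat) (N_gt1 : (1 < N)%N).
Local Notation P := (trace_poly F X).
Local Notation "f =I g" := (cong I f g) (at level 70).
Variables (congC : forall f g : P, f * g =I g * f)
  (cong_tr : forall f : P, free_trace f =I free_trace 1 * f)
  (cong_expN : forall f : P, f ^+ N =I f).

(** Modulo [I], [f] is a polynomial in [t(1)] and the variables of [s], of
    degree less than [N] in each variable.  The form is nested, one variable at
    a time, so that the vanishing argument can treat it as a polynomial in the
    first variable.  Congruence is allowed at every level: the coefficients are
    only known up to [I], and no representative has to be chosen. *)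
Fixpoint reducible (s : seq X) (f : P) : Prop :=
  if s is x :: s' then
    exists2 g : 'I_N -> P, forall i, reducible s' (g i)
      & f =I \sum_i g i * tpvar F x ^+ i
  else exists p : {poly F}, f =I horner_alg (free_trace 1) p.

Lemma reducible_cong s f g : f =I g -> reducible s g -> reducible s f.
Proof.
move=> fg; case: s => [|x s] /= [h]; last move=> redh.
  by exists h; apply: cong_trans fg _.
by exists h => //; apply: cong_trans fg _.
Qed.

Lemma reducible_horner s p : reducible s (horner_alg (free_trace 1) p).
Proof.
elim: s p => [|x s IHs] p /=; first by exists p; exact: cong_refl.
pose i0 := Ordinal (ltnW N_gt1).
exists (fun i => horner_alg (free_trace 1) (if i == i0 then p else 0)) => //.
rewrite (bigD1 i0) //= mulr1 big1 ?addr0; first exact: cong_refl.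
by move=> i /negPf->; rewrite rmorph0 mul0r.
Qed.

Lemma reducible0 s : reducible s 0.
Proof.
rewrite -(rmorph0 (horner_alg (free_trace 1))); exact: reducible_horner.
Qed.

Lemma reducible1 s : reducible s 1.
Proof.
rewrite -(rmorph1 (horner_alg (free_trace 1))); exact: reducible_horner.
Qed.

Lemma reducibleD s f g : reducible s f -> reducible s g -> reducible s (f + g).
Proof.
elim: s f g => [|x s IHs] f g /=.
  move=> [p fp] [r gr]; exists (p + r).
  by rewrite rmorphD; exact: congD.
move=> [a reda fa] [b redb gb]; exists (fun i => a i + b i).
  by move=> i; exact: IHs.
under eq_bigr do rewrite mulrDl.
by rewrite big_split; exact: congD.
Qed.

Lemma reducible_sum (J : finType) s (f : J -> P) :
  (forall j, reducible s (f j)) -> reducible s (\sum_j f j).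
Proof.
move=> redf; apply: (big_ind (reducible s)) => //; first exact: reducible0.
exact: reducibleD.
Qed.

(** Exponents that are too large are lowered by [x ^+ N = x], which replaces [k]
    by [k - N + 1]; this is smaller than [k] because [1 < N]. *)
Lemma reducible_consX s x g k :
  reducible s g -> reducible (x :: s) (g * tpvar F x ^+ k).
Proof.
move=> redg; elim/ltn_ind: k => k IHk; have [ltkN | leNk] := ltnP k N.
  exists (fun i => if i == Ordinal ltkN then g else 0) => [i|].
    by case: ifP => // _; exact: reducible0.
  rewrite (bigD1 (Ordinal ltkN)) //= eqxx big1 ?addr0; first exact: cong_refl.
  by move=> i /negPf->; rewrite mul0r.
apply: (@reducible_cong _ _ (g * tpvar F x ^+ (k - N).+1)).
  apply: (congM idealI (cong_refl idealI g)).
  rewrite -{1}(subnK leNk) exprD exprSr.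
  by apply: (congM idealI); [exact: cong_refl | exact: cong_expN].
by apply: IHk; rewrite -addn2 -{2}(subnK leNk) leq_add2l.
Qed.

Lemma reducible_cons s x f : reducible s f -> reducible (x :: s) f.
Proof. by move=> /(reducible_consX x 0); rewrite expr0 mulr1. Qed.

Lemma reducible_var s x : x \in s -> reducible s (tpvar F x).
Proof.
elim: s => // y s IHs; rewrite inE => /predU1P[<-|/IHs/reducible_cons//].
by have := reducible_consX x 1 (reducible1 s); rewrite expr1 mul1r.
Qed.

(** The only place where commutativity modulo [I] enters: in a product of two
    nested forms, a power of [x] has to pass a coefficient. *)
Lemma reducibleM s f g : reducible s f -> reducible s g -> reducible s (f * g).
Proof.
elim: s f g => [|x s IHs] f g.
  move=> [p fp] [r gr]; exists (p * r).
  by rewrite rmorphM; exact: congM.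
move=> [a reda fa] [b redb gb]; apply: reducible_cong (congM idealI fa gb) _.
rewrite big_distrlr; apply: reducible_sum => i; apply: reducible_sum => j.
apply: (@reducible_cong _ _ (a i * b j * tpvar F x ^+ (i + j))).
  rewrite /= exprD -!mulrA; apply: (congM idealI); first exact: cong_refl.
  by rewrite !mulrA; apply: (congM idealI) => //; exact: cong_refl.
by apply: reducible_consX; apply: IHs; [exact: reda | exact: redb].
Qed.

Lemma reducibleZ s k f : reducible s f -> reducible s (k *: f).
Proof.
move=> redf; rewrite -mulr_algl -(horner_algC (free_trace 1)).
by apply: reducibleM => //; exact: reducible_horner.
Qed.

Lemma reducible_tr s f : reducible s f -> reducible s (free_trace f).
Proof.
move=> redf; apply: reducible_cong (cong_tr f) _; apply: reducibleM => //.
by rewrite -(horner_algX (free_trace 1)); exact: reducible_horner.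
Qed.

Fixpoint term_vars (u : term F X) : seq X :=
  match u with
  | Tvar x => [:: x]
  | Tzero | Tone => [::]
  | Tadd u1 u2 | Tmul u1 u2 => term_vars u1 ++ term_vars u2
  | Tscale _ u1 | Ttr u1 => term_vars u1
  end.

Lemma reducible_pi (u : term F X) s :
  {subset term_vars u <= s} -> reducible s (\pi_P u)%qT.
Proof.
elim: u => [x|||u IHu w IHw|k u IHu|u IHu w IHw|u IHu] /= sub.
- by apply: reducible_var; apply: sub; exact: mem_head.
- exact: reducible0.
- exact: reducible1.
- rewrite -tp_addE; apply: reducibleD; [apply: IHu|apply: IHw] => x xu;
    by apply: sub; rewrite mem_cat xu ?orbT.
- by rewrite -tp_scaleE; apply: reducibleZ; exact: IHu.
- rewrite -tp_mulE; apply: reducibleM; [apply: IHu|apply: IHw] => x xu;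
    by apply: sub; rewrite mem_cat xu ?orbT.
- by rewrite -tp_trE; apply: reducible_tr; exact: IHu.
Qed.

Lemma reducible_uniq f : exists2 s, uniq s & reducible s f.
Proof.
elim/quotW: f => u; exists (undup (term_vars u)); first exact: undup_uniq.
by apply: reducible_pi => x; rewrite mem_undup.
Qed.

Section Vanishing.
Variables (A : algType F) (t : trace A) (I_Id : I `<=` Id X t).

Lemma teval_cong v f g : f =I g -> teval t v f = teval t v g.
Proof. by move=> /I_Id /(_ v) /eqP; rewrite raddfB subr_eq0 => /eqP. Qed.

(** In the nested form over [x :: s], the coefficients do not see the value of
    [x]: that value can vary while the coefficients stay fixed. *)
Lemma teval_reducible s f (v v' : X -> A) :
  reducible s f -> {in s, v =1 v'} -> teval t v f = teval t v' f.
Proof.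
elim: s f => [|x s IHs] f /=.
  by move=> [p fp] _; rewrite !(teval_cong _ fp) !teval_horner_tr1.
move=> [g redg fg] eqv; rewrite !(teval_cong _ fg) !raddf_sum /=.
apply: eq_bigr => i _; rewrite !rmorphM !rmorphXn /= !teval_var.
rewrite (eqv x) ?mem_head // (IHs (g i)) // => y ys.
by apply: eqv; rewrite inE ys orbT.
Qed.

End Vanishing.
End Reduction.

(** * Minimal polynomials and small polynomials over a finite extension *)

Lemma horner_alg_min_poly (F : fieldType) (E : fieldExtType F) (a : E) :
  horner_alg a (min_poly a) = 0.
Proof. by have /rootP := root_minPoly 1%AS a; rewrite -map_min_poly. Qed.

Lemma min_poly_dvd (F : fieldType) (E : fieldExtType F) (a : E) (p : {poly F}) :
  horner_alg a p = 0 -> min_poly a %| p.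
Proof.
move=> pa0; rewrite -(dvdp_map (in_alg E)) map_min_poly.
apply: minPoly_dvdp; last by apply/rootP.
by apply/polyOver1P; exists p.
Qed.

Section FiniteExtension.
Variables (F : finFieldType) (E : fieldExtType F).
Local Notation N := (#|F| ^ \dim {:E})%N.

Lemma card_finvect : #|finvect_type E| = N.
Proof.
rewrite -(@card_vspacef F _ (Vector.class (finvect_type E))).
exact: card_vspace.
Qed.

Lemma expf_card_ext (a : E) : a ^+ N = a.
Proof. by rewrite -card_finvect; exact: (@expf_card (FinFieldExtType E) a). Qed.

Lemma small_poly_eq0 (p : {poly E}) :
  (size p <= N)%N -> (forall a, p.[a] = 0) -> p = 0.
Proof.
move=> szp p0; apply/eqP; apply: contraTT szp => nz_p.
rewrite -ltnNge -card_finvect cardE.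
apply: (max_poly_roots (rs := enum (finvect_type E)) nz_p).
  by apply/allP => a _; apply/rootP.
exact: enum_uniq.
Qed.

End FiniteExtension.

(** * Capelli polynomials *)

Section Capelli.
Variables (F : fieldType) (X : choiceType).

Lemma commutator_capelli (x y : X) : x != y ->
  capelli F X 2 (tpvar F x * tpvar F y - tpvar F y * tpvar F x).
Proof.
move=> neq_xy; pose z (i : 'I_2) := if i == ord0 then x else y.
have codz : codom z ++ [::] = [:: x; y].
  by rewrite cats0 /codom /image_mem enum_ordSl enum_ordSl enum_ord0.
exists z, [::]; rewrite codz; split.
- by rewrite /= inE neq_xy.
- exists 2%N, (fun i => if i == ord0 then 1 else -1).
  exists (fun i => if i == ord0 then tpvar F x * tpvar F y
                   else tpvar F y * tpvar F x).
  split; last by rewrite big_ord_recl big_ord1 /= scale1r scaleN1r.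
  move=> i; case: ifP => _.
    exists [:: x; y] => //.
    by apply: (@trace_monomialM _ _ [:: x] [:: y]); exact: trace_monomial_var.
  exists [:: y; x]; first by rewrite (perm_catC [:: y] [:: x]).
  by apply: (@trace_monomialM _ _ [:: y] [:: x]); exact: trace_monomial_var.
- move=> i j neq_ij; rewrite raddfB /= !rmorphM /= !teval_var.
  suff E w : w \in [:: x; y] -> (if w == z j then z i else w) = z i.
    by rewrite !E ?subrr // !inE eqxx ?orbT.
  have: w \in [:: x; y] -> w = z i \/ w = z j.
    rewrite !inE /z; case: i j neq_ij => [[|[|//]] ?] [[|[|//]] ?] //= _;
      by case/orP => /eqP; auto.
  by move=> h /h [] ->; case: ifP => // /eqP.
Qed.

(** The exponent [k] is the number of traces in the monomial, and the point is
    that it does not depend on [v]. *)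
Lemma teval_trace_monomial (A : comAlgType F) (alpha : A) (s : seq X) w :
  trace_monomial s w ->
  exists k, forall v : X -> A,
    teval (scale_trace alpha) v w = alpha ^+ k * \prod_(x <- s) v x.
Proof.
elim=> [|x|s1 s2 w1 w2 _ [k1 E1] _ [k2 E2]|s1 w1 _ [k E]].
- by exists 0%N => v; rewrite rmorph1 big_nil mulr1.
- by exists 0%N => v; rewrite teval_var big_seq1 mul1r.
- by exists (k1 + k2)%N => v; rewrite rmorphM /= E1 E2 big_cat exprD mulrACA.
- by exists k.+1 => v; rewrite teval_tr /= E mulrA exprS.
Qed.

(** Evaluations see a multilinear polynomial only through one constant [C], and
    identifying two variables before sending all of them to 1 shows [C = 0]. *)
Lemma capelli_Id (A : comAlgType F) (alpha : A) (m : nat) :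
  (1 < m)%N -> capelli F X m `<=` Id X (scale_trace alpha).
Proof.
move=> m_gt1 f [x [y [_ [n [c [w [mon_w f_def]]]] alt_f]]] v.
have /fin_all_exists [k Ek] i : exists k, forall v : X -> A,
    teval (scale_trace alpha) v (w i) =
      alpha ^+ k * \prod_(z <- codom x ++ y) v z.
  have [s eq_s /(teval_trace_monomial alpha)[k E]] := mon_w i.
  by exists k => u; rewrite E (perm_big _ eq_s).
pose C := \sum_i c i *: alpha ^+ k i.
have Ef u : teval (scale_trace alpha) u f = C * \prod_(z <- codom x ++ y) u z.
  rewrite f_def raddf_sum mulr_suml; apply: eq_bigr => i _.
  by rewrite /= linearZ /= Ek scalerAl.
suff C0 : C = 0 by rewrite Ef C0 mul0r.
pose i0 := Ordinal (ltnW m_gt1); pose i1 := Ordinal m_gt1.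
have := congr1 (teval (scale_trace alpha) (fun=> 1)) (alt_f i0 i1 isT).
rewrite raddf0 teval_endo; last exact: teval_tr.
by rewrite Ef big1 ?mulr1 // => z _; rewrite /= !teval_var.
Qed.

End Capelli.

(** * Identities of bounded degree *)

Section BoundedIdentities.
Variables (F : finFieldType) (E : fieldExtType F) (alpha : E) (X : choiceType).
Local Notation P := (trace_poly F X).
Local Notation N := (#|F| ^ \dim {:E})%N.
Local Notation t := (scale_trace alpha).
Variables (I : set P) (idealI : Tideal I) (I_Id : I `<=` Id X t).
Variable I_min_poly : I (horner_alg (free_trace 1) (min_poly alpha)).

(** Induction on the variables.  With the values of the other variables fixed,
    an identity is a polynomial of degree less than [N] in the first one with
    [N] roots, so its coefficients are identities in fewer variables. *)
Lemma reducible_Id s f : uniq s -> reducible I N s f -> Id X t f -> I f.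
Proof.
elim: s f => [|x s IHs] f /=.
  move=> _ [p fp] f_Id; apply: (Tideal_cong idealI fp).
  have: horner_alg alpha p = 0.
    rewrite -[alpha]mulr1 -(teval_horner_tr1 t (fun _ : X => 0)).
    by rewrite -(teval_cong I_Id _ fp) f_Id.
  move=> /min_poly_dvd/dvdpP[r ->]; rewrite rmorphM.
  exact: TidealMl.
move=> /andP[x_notin_s uniq_s] [g redg fg] f_Id.
suff Ig i : I (g i).
  apply: (Tideal_cong idealI fg); apply: (big_ind I) => [||i _].
  - exact: Tideal0.
  - exact: TidealD.
  - exact: TidealMr.
apply: IHs => // v.
(* The partial function [insub] only turns the natural number [j] < [N] into an
   index of [g]; the default 0 is never a coefficient of [p]. *)
pose p := \poly_(j < N) (if insub j is Some k then teval t v (g k) else 0).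
have p0 : p = 0.
  apply: small_poly_eq0 => [|a]; first exact: size_poly.
  pose va y := if y == x then a else v y.
  rewrite -[RHS](f_Id va) (teval_cong I_Id va fg) raddf_sum horner_poly.
  apply: eq_bigr => k _; rewrite valK /= rmorphM rmorphXn /= teval_var /va eqxx.
  congr (_ * _); apply: (teval_reducible I_Id (redg k)) => y ys.
  by case: eqP ys x_notin_s => // -> ->.
have := congr1 (fun q : {poly E} => q`_i) p0.
by rewrite /p coef_poly ltn_ord valK coef0.
Qed.

End BoundedIdentities.

Theorem theorem21 (F : finFieldType) (E : fieldExtType F)
    (hE : \dim {:E}%VS = 2%N) (alpha : E)
    (X : choiceType) (hX : infinite_set [set: X]) :
  Id X (scale_trace alpha) =
  Tgen ([set horner_alg (free_trace 1) (min_poly alpha)]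
    `|` [set free_trace (tpvar F x) - free_trace 1 * tpvar F x | x in [set: X]]
    `|` [set tpvar F x ^+ (#|F| ^ 2) - tpvar F x | x in [set: X]]
    `|` capelli F X 2).
Proof.
set S := (X in Tgen X); set t := scale_trace alpha.
have S_Id : S `<=` Id X t.
  move=> f [[[->|[x _ <-]]|[x _ <-]]|]; last exact: capelli_Id.
  - by move=> v; rewrite teval_horner_tr1 /= mulr1 horner_alg_min_poly.
  - by move=> v; rewrite raddfB /= rmorphM /= !teval_tr rmorph1 /= mulr1 subrr.
  - move=> v; rewrite raddfB /= rmorphXn /= teval_var.
    by rewrite -hE expf_card_ext subrr.
have J_Id : Tgen S `<=` Id X t by apply: smallest_sub => //; exact: Tideal_Id.
have S_J : S `<=` Tgen S by exact: sub_gen_smallest.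
have idealJ : Tideal (Tgen S) := Tideal_Tgen S.
have [x _] := infinite_setN0 hX.
have [y [_ neq_yx]] := infinite_setN0 (infinite_setD hX (finite_set1 x)).
have neq_xy : x != y by apply/eqP => eq_xy; exact: neq_yx.
have congC f g : cong (Tgen S) (f * g) (g * f).
  have := Tideal_subst idealJ (fun z => if z == x then f else g)
    (S_J _ (or_intror (commutator_capelli F neq_xy))).
  rewrite raddfB /= !rmorphM /= !teval_var eqxx.
  by rewrite eq_sym (negPf neq_xy).
have cong_tr f : cong (Tgen S) (free_trace f) (free_trace 1 * f).
  have /(Tideal_subst idealJ (fun=> f)) :
      Tgen S (free_trace (tpvar F x) - free_trace 1 * tpvar F x).
    by apply: S_J; left; left; right; exists x.
  by rewrite raddfB /= rmorphM /= !teval_tr rmorph1 teval_var.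
have cong_expN f : cong (Tgen S) (f ^+ (#|F| ^ \dim {:E})) f.
  have /(Tideal_subst idealJ (fun=> f)) :
      Tgen S (tpvar F x ^+ (#|F| ^ \dim {:E}) - tpvar F x).
    by rewrite hE; apply: S_J; left; right; exists x.
  by rewrite raddfB /= rmorphXn /= teval_var.
have N_gt1 : (1 < #|F| ^ \dim {:E})%N.
  by rewrite hE -{1}(exp1n 2) ltn_exp2r ?finNzRing_gt1.
apply/seteqP; split=> // f f_Id.
have [s uniq_s red_f] := reducible_uniq idealJ N_gt1 congC cong_tr cong_expN f.
apply: (reducible_Id idealJ J_Id _ uniq_s red_f f_Id).
by apply: S_J; left; left; left.
Qed.
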